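(* Let $m,k$ be integers with $4>m>k\ge 1$, let $a\in\mathbb{Q}$, and let $f_{4,m,k}(a,x)=x^4+x^m+x^k+a$. Then $f_{4,m,k}(a,x)$ has a quadratic factor over $\mathbb{Q}$ precisely in the following cases (where $p,q\in\mathbb{Q}$): (1) If $(m,k)=(2,1)$, then $f_{4,2,1}(a,x)$ is divisible by $x^2+px+q$ if and only if $p\neq 0$ and $$a=\frac{(p^3+p-1)(p^3+p+1)}{4p^2},\qquad q=\frac{p^3+p-1}{2p}.$$ In this case $$f_{4,2,1}(a,x)=\left(x^2-px+\frac{p^3+p+1}{2p}\right)\left(x^2+px+\frac{p^3+p-1}{2p}\right).$$ (2) If $(m,k)=(3,1)$, then $f_{4,3,1}(a,x)$ is divisible by $x^2+px+q$ if and only if $p\ne \frac12$ and $$a=\frac{(p^3-2p^2+p+1)(p^3-p^2-1)}{(2p-1)^2},\qquad q=\frac{p^3-p^2-1}{2p-1}.$$ In this case $$f_{4,3,1}(a,x)=\left(x^2-(p-1)x+\frac{p^3-2p^2+p+1}{2p-1}\right)\left(x^2+px+\frac{p^3-p^2-1}{2p-1}\right).$$ (3) If $(m,k)=(3,2)$, then $f_{4,3,2}(a,x)$ is divisible by $x^2+px+q$ if and only if $p\neq\frac12$ and $$a=\frac{(p-1)p(p^2-p+1)^2}{(2p-1)^2},\qquad q=\frac{p(p^2-p+1)}{2p-1}.$$ In this case $$f_{4,3,2}(a,x)=\left(x^2-(p-1)x+\frac{(p-1)(p^2-p+1)}{2p-1}\right)\left(x^2+px+\frac{p(p^2-p+1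)}{2p-1}\right).$$
   Context: All polynomials have rational coefficients, and divisibility and factorization are over $\mathbb{Q}$. *)

(* Defs.v *)
From mathcomp Require Import all_boot all_order all_algebra.

Set Implicit Arguments.
Unset Strict Implicit.
Unset Printing Implicit Defensive.

Import GRing.Theory.
Local Open Scope ring_scope.

Definition quadrinomial (n m k : nat) (a : rat) : {poly rat} :=
  'X^n + 'X^m + 'X^k + a%:P.

Definition monic_quadratic (b c : rat) : {poly rat} :=
  'X^2 + b *: 'X + c%:P.

(* The quadratic factor is neither assumed monic nor irreducible. *)
Definition has_quadratic_factor (f : {poly rat}) : Prop :=
  exists2 g : {poly rat}, size g = 3%N & g %| f.

(* [cond_mk a p q]: the parameter condition under which x^2 + p x + q divides
   x^4 + x^m + x^k + a. *)
Definition cond_21 (a p q : rat) : Prop :=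
  [/\ p != 0,
      a = (p ^+ 3 + p - 1) * (p ^+ 3 + p + 1) / (4 * p ^+ 2)
    & q = (p ^+ 3 + p - 1) / (2 * p)].

Definition cond_31 (a p q : rat) : Prop :=
  [/\ p != 1 / 2,
      a = (p ^+ 3 - 2 * p ^+ 2 + p + 1) * (p ^+ 3 - p ^+ 2 - 1)
          / (2 * p - 1) ^+ 2
    & q = (p ^+ 3 - p ^+ 2 - 1) / (2 * p - 1)].

Definition cond_32 (a p q : rat) : Prop :=
  [/\ p != 1 / 2,
      a = (p - 1) * p * (p ^+ 2 - p + 1) ^+ 2 / (2 * p - 1) ^+ 2
    & q = p * (p ^+ 2 - p + 1) / (2 * p - 1)].

(* Main.v *)
(* Division with remainder by x^2 + p x + q leaves a linear remainder. The
   vanishing of its coefficient of x is a linear equation in q whose leading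
   coefficient is 2 p or 2 p - 1; where the latter vanishes the equation reads
   0 = c with c nonzero, so q is a rational function of p. The vanishing of the
   constant term then gives a. *)
Require Import Defs.
From mathcomp Require Import all_boot all_order all_algebra.
From mathcomp Require Import ring lra.

Import GRing.Theory.
Local Open Scope ring_scope.

(** A shape with all four coefficients free, so that a single division covers the three
    quadrinomials. *)
Definition quartic (A B C D : rat) : {poly rat} :=
  'X^4 + A *: 'X^3 + B *: 'X^2 + C *: 'X + D%:P.

Lemma monic_quadraticM (b c p q : rat) :
  monic_quadratic b c * monic_quadratic p q =
  quartic (b + p) (c + q + b * p) (b * q + c * p) (c * q).
Proof. rewrite /monic_quadratic /quartic -!mul_polyC; ring. Qed.

Lemma monic_quadraticE (p q : rat) :
  monic_quadratic p q = Poly [:: q; p; 1].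
Proof. by rewrite /monic_quadratic /= !cons_poly_def -!mul_polyC; ring. Qed.

Lemma size_monic_quadratic (p q : rat) : size (monic_quadratic p q) = 3%N.
Proof. by rewrite monic_quadraticE (@PolyK _ 0) //= oner_neq0. Qed.

(** The coefficients of ['X^3] and ['X^2] force the quotient to be [monic_quadratic (A - p) r]; the
    two equations say that the remainder vanishes. *)
Lemma monic_quadratic_dvd_quartic (A B C D p q : rat) :
  let r := B - q - p * (A - p) in
  monic_quadratic p q %| quartic A B C D <->
  C = q * (A - p) + p * r /\ D = q * r.
Proof.
(* The remainder is [s *: 'X + t%:P]. *)
move=> r; pose s := C - q * (A - p) - p * r; pose t := D - q * r.
have -> : quartic A B C D =
    monic_quadratic (A - p) r * monic_quadratic p q + Poly [:: t; s].
  rewrite monic_quadraticM /quartic /= !cons_poly_def -!mul_polyC /s /t /r.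
  by ring.
rewrite dvdp_addr ?dvdp_mulIr //; split=> [dvd_st | [Cr Dr]].
  (* A nonzero multiple of the quadratic has size at least 3, whereas the remainder has size at most
     2. *)
  have /eqP st0 : Poly [:: t; s] == 0.
    apply: contraLR dvd_st => /dvdp_leq le_st; apply/negP => /le_st.
    by rewrite size_monic_quadratic leqNgt ltnS size_Poly.
  have : (Poly [:: t; s])`_0 = 0 by rewrite st0 coef0.
  have : (Poly [:: t; s])`_1 = 0 by rewrite st0 coef0.
  by rewrite !coef_Poly /= /s /t; split; lra.
have -> : s = 0 by rewrite /s; lra.
have -> : t = 0 by rewrite /t; lra.
by rewrite /= !cons_poly_def polyC0 !(mul0r, addr0) dvdp0.
Qed.

(** Over a field, dividing a factor by its leading coefficient makes it monic and preserves
    divisibility. *)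
Lemma has_quadratic_factorP (f : {poly rat}) :
  has_quadratic_factor f <-> exists p q, monic_quadratic p q %| f.
Proof.
split=> [[g size_g dvd_gf] | [p [q dvd_f]]]; last first.
  by exists (monic_quadratic p q) => //; exact: size_monic_quadratic.
have g2_neq0 : g`_2 != 0.
  by rewrite -[2%N]/(3.-1) -size_g -lead_coefE lead_coef_eq0 -size_poly_eq0 size_g.
exists (g`_1 / g`_2), (g`_0 / g`_2).
suff -> : monic_quadratic (g`_1 / g`_2) (g`_0 / g`_2) = (g`_2)^-1 *: g.
  by rewrite dvdpZl ?invr_neq0.
apply/polyP=> i; rewrite monic_quadraticE coef_Poly coefZ.
case: i => [|[|[|i]]] /=; rewrite 1?mulrC ?divff //.
(* From index 3 on, both coefficients are zero. *)
by rewrite nth_nil [g`__]nth_default ?mul0r // size_g.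
Qed.

Lemma quadrinomial_21 (a : rat) : quadrinomial 4 2 1 a = quartic 0 1 1 a.
Proof. by rewrite /quadrinomial /quartic -!mul_polyC; ring. Qed.

Lemma quadrinomial_31 (a : rat) : quadrinomial 4 3 1 a = quartic 1 0 1 a.
Proof. by rewrite /quadrinomial /quartic -!mul_polyC; ring. Qed.

Lemma quadrinomial_32 (a : rat) : quadrinomial 4 3 2 a = quartic 1 1 0 a.
Proof. by rewrite /quadrinomial /quartic -!mul_polyC; ring. Qed.

Lemma double_sub1_neq0 (p : rat) : p != 1 / 2 -> 2 * p - 1 != 0.
Proof. by move=> p_neq; apply: contra_neq p_neq; lra. Qed.

Lemma dvd_quadrinomial_21 (a p q : rat) :
  monic_quadratic p q %| quadrinomial 4 2 1 a <-> cond_21 a p q.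
Proof.
rewrite quadrinomial_21; split=> [/monic_quadratic_dvd_quartic [eq1 ->] | ].
  (* Here [eq1] amounts to [2 * p * q = p ^+ 3 + p - 1], which reads 0 = -1 at [p = 0]. *)
  have p_neq0 : p != 0 by apply/eqP=> p0; move: eq1; rewrite p0; lra.
  have -> : q = (p ^+ 3 + p - 1) / (2 * p).
    have p2_neq0 : 2 * p != 0 by rewrite mulf_neq0.
    by apply: (canRL (mulfK p2_neq0)); lra.
  by split=> //; field.
by case=> p_neq0 -> ->; apply/monic_quadratic_dvd_quartic; split; field.
Qed.

Lemma dvd_quadrinomial_31 (a p q : rat) :
  monic_quadratic p q %| quadrinomial 4 3 1 a <-> cond_31 a p q.
Proof.
rewrite quadrinomial_31; split=> [/monic_quadratic_dvd_quartic [eq1 ->] | ].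
  (* Here [eq1] amounts to [(2 * p - 1) * q = p ^+ 3 - p ^+ 2 - 1], whose right side is -9/8 at
     [p = 1 / 2]. *)
  have p_neq : p != 1 / 2 by apply/eqP=> p0; move: eq1; rewrite p0; lra.
  have p2_neq0 := double_sub1_neq0 _ p_neq.
  have -> : q = (p ^+ 3 - p ^+ 2 - 1) / (2 * p - 1).
    by apply: (canRL (mulfK p2_neq0)); lra.
  by split=> //; field.
case=> /double_sub1_neq0 p2_neq0 -> ->.
by apply/monic_quadratic_dvd_quartic; split; field.
Qed.

Lemma dvd_quadrinomial_32 (a p q : rat) :
  monic_quadratic p q %| quadrinomial 4 3 2 a <-> cond_32 a p q.
Proof.
rewrite quadrinomial_32; split=> [/monic_quadratic_dvd_quartic [eq1 ->] | ].
  (* Here [eq1] amounts to [(2 * p - 1) * q = p * (p ^+ 2 - p + 1)], whose right side is 3/8 at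
     [p = 1 / 2]. *)
  have p_neq : p != 1 / 2 by apply/eqP=> p0; move: eq1; rewrite p0; lra.
  have p2_neq0 := double_sub1_neq0 _ p_neq.
  have -> : q = p * (p ^+ 2 - p + 1) / (2 * p - 1).
    by apply: (canRL (mulfK p2_neq0)); lra.
  by split=> //; field.
case=> /double_sub1_neq0 p2_neq0 -> ->.
by apply/monic_quadratic_dvd_quartic; split; field.
Qed.

Theorem theorem2p1 (m k : nat) (a : rat)
    (hm : (m < 4)%N) (hkm : (k < m)%N) (hk : (1 <= k)%N) :
  let f := quadrinomial 4 m k a in
  [/\ has_quadratic_factor f <->
        (exists p q : rat,
          [\/ (m, k) = (2, 1)%N /\ cond_21 a p q,
              (m, k) = (3, 1)%N /\ cond_31 a p q
            | (m, k) = (3, 2)%N /\ cond_32 a p q]),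
      (m, k) = (2, 1)%N -> forall p q : rat,
        (monic_quadratic p q %| f <-> cond_21 a p q) /\
        (cond_21 a p q ->
         f = monic_quadratic (- p) ((p ^+ 3 + p + 1) / (2 * p)) *
             monic_quadratic p ((p ^+ 3 + p - 1) / (2 * p))),
      (m, k) = (3, 1)%N -> forall p q : rat,
        (monic_quadratic p q %| f <-> cond_31 a p q) /\
        (cond_31 a p q ->
         f = monic_quadratic (- (p - 1))
               ((p ^+ 3 - 2 * p ^+ 2 + p + 1) / (2 * p - 1)) *
             monic_quadratic p ((p ^+ 3 - p ^+ 2 - 1) / (2 * p - 1)))
    & (m, k) = (3, 2)%N -> forall p q : rat,
        (monic_quadratic p q %| f <-> cond_32 a p q) /\
        (cond_32 a p q ->
         f = monic_quadratic (- (p - 1))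
               ((p - 1) * (p ^+ 2 - p + 1) / (2 * p - 1)) *
             monic_quadratic p (p * (p ^+ 2 - p + 1) / (2 * p - 1)))].
Proof.
move=> f; split.
- rewrite has_quadratic_factorP {}/f.
  have [||] : [\/ (m, k) = (2, 1)%N, (m, k) = (3, 1)%N | (m, k) = (3, 2)%N].
  + by case: m k hm hkm hk => [|[|[|[|?]]]] [|[|[|?]]] //= _ _ _;
      [constructor 1 | constructor 2 | constructor 3].
  + move=> [-> ->]; split=> -[p [q pq]]; exists p, q.
      by constructor 1; split=> //; apply/dvd_quadrinomial_21.
    (* The disjuncts for the other two pairs equate distinct numerals. *)
    by case: pq => -[] // _ /dvd_quadrinomial_21.
  + move=> [-> ->]; split=> -[p [q pq]]; exists p, q.
      by constructor 2; split=> //; apply/dvd_quadrinomial_31.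
    by case: pq => -[] // _ /dvd_quadrinomial_31.
  + move=> [-> ->]; split=> -[p [q pq]]; exists p, q.
      by constructor 3; split=> //; apply/dvd_quadrinomial_32.
    by case: pq => -[] // _ /dvd_quadrinomial_32.
- case=> m2 k1 p q; rewrite /f m2 k1; split; first exact: dvd_quadrinomial_21.
  (* With [a] substituted, the factorization becomes an equality of coefficients between two
     [quartic] terms. *)
  case=> p_neq0 -> _; rewrite quadrinomial_21 monic_quadraticM.
  by congr quartic; field.
- case=> m3 k1 p q; rewrite /f m3 k1; split; first exact: dvd_quadrinomial_31.
  case=> /double_sub1_neq0 p2_neq0 -> _; rewrite quadrinomial_31 monic_quadraticM.
  by congr quartic; field.
- case=> m3 k2 p q; rewrite /f m3 k2; split; first exact: dvd_quadrinomial_32.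
  case=> /double_sub1_neq0 p2_neq0 -> _; rewrite quadrinomial_32 monic_quadraticM.
  by congr quartic; field.
Qed.
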